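(* Let $G$ be a $3$-regular graph of order $n\ge 6$ with no component isomorphic to $K_{3,3}$. Then $\gamma_P(G)\cdot\gamma_P(\overline{G})\le 2\left\lfloor\frac{n}{4}\right\rfloor$, where $\overline{G}$ is the complement of $G$, and this bound is attained for arbitrarily large $n$.
   Context: All graphs are finite, simple, undirected, with nonempty vertex set; the order is the number of vertices. $N(v)$ is the set of neighbors of $v$, $N[v]=N(v)\cup\{v\}$, and $N[S]=\bigcup_{v\in S}N[v]$. For $S\subseteq V(G)$, define $PD(S)$ by: (1) start with $PD(S):=N[S]$; (2) while there exists $v\in PD(S)$ with $|N(v)\setminus PD(S)|=1$, set $PD(S):=PD(S)\cup N(v)$. $S$ is a power dominating set if $PD(S)=V(G)$ at the end of the process. The power domination number $\gamma_P(G)$ is the minimum cardinality of a power dominating set of $G$. *)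

(* Defs.v *)
From mathcomp Require Import all_boot.

Set Implicit Arguments.
Unset Strict Implicit.
Unset Printing Implicit Defensive.

(** Finite simple undirected graphs. *)
Record sgraph := SGraph {
  vertex :> finType;
  adj : rel vertex;
  adj_sym : symmetric adj;
  adj_irr : irreflexive adj }.

Arguments adj {s} x y : rename.

Definition regular (d : nat) (G : sgraph) : Prop :=
  forall v : G, #|[set w | adj v w]| = d.

Section Complement.
Variable G : sgraph.

Definition compl_adj : rel G := fun x y => (x != y) && ~~ adj x y.

Lemma compl_adj_sym : symmetric compl_adj.
Proof. by move=> x y; rewrite /compl_adj eq_sym adj_sym. Qed.

Lemma compl_adj_irr : irreflexive compl_adj.
Proof. by move=> x; rewrite /compl_adj eqxx. Qed.

Definition complement : sgraph := SGraph compl_adj_sym compl_adj_irr.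

End Complement.

Section Induced.
Variables (G : sgraph) (C : {set G}).

Definition induced_adj : rel {x : G | x \in C} :=
  fun x y => adj (val x) (val y).

Lemma induced_adj_sym : symmetric induced_adj.
Proof. by move=> x y; rewrite /induced_adj adj_sym. Qed.

Lemma induced_adj_irr : irreflexive induced_adj.
Proof. by move=> x; rewrite /induced_adj adj_irr. Qed.

Definition induced : sgraph := SGraph induced_adj_sym induced_adj_irr.

End Induced.

Section CompleteBipartite.
Variables m n : nat.

Definition bip_adj : rel ('I_m + 'I_n)%type := fun x y =>
  match x, y with
  | inl _, inr _ | inr _, inl _ => true
  | _, _ => false
  end.

Lemma bip_adj_sym : symmetric bip_adj.
Proof. by move=> [x|x] [y|y]. Qed.

Lemma bip_adj_irr : irreflexive bip_adj.
Proof. by move=> [x|x]. Qed.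

Definition complete_bipartite : sgraph := SGraph bip_adj_sym bip_adj_irr.

End CompleteBipartite.

Definition isomorphic (G H : sgraph) : Prop :=
  exists2 f : G -> H, bijective f & forall x y, adj (f x) (f y) = adj x y.

Definition components (G : sgraph) : {set {set G}} :=
  [set [set y | connect adj x y] | x : G].

Section PowerDomination.
Variable G : sgraph.
Implicit Types (v : G) (S A B : {set G}).

Definition nbh v : {set G} := [set w | adj v w].
Definition cl_nbh v : {set G} := v |: nbh v.
Definition cl_nbh_set S : {set G} := \bigcup_(v in S) cl_nbh v.

Definition forces A v : bool := (v \in A) && (#|nbh v :\: A| == 1).

Definition pd_step A : {set G} :=
  if [pick v | forces A v] is Some v then A :|: nbh v else A.

(** Every step made while some [v] forces enlarges the set, so [#|G|] steps
    exhaust the while loop ([PD_final]); [PD_unique] shows that the result does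
    not depend on the vertices picked along the way. *)
Definition PD S : {set G} := iter #|G| pd_step (cl_nbh_set S).

Definition power_dominating S : bool := PD S == [set: G].

(** [[set: G]] is power dominating, so this is a genuine minimum. *)
Definition power_dom_number : nat :=
  #|[arg min_(S < [set: G] | power_dominating S) #|S| ]|.

Lemma sub_pd_step A : A \subset pd_step A.
Proof. by rewrite /pd_step; case: pickP => // v _; apply: subsetUl. Qed.

Lemma PD_final S v : ~~ forces (PD S) v.
Proof.
have grow k : pd_step (iter k pd_step (cl_nbh_set S)) =
    iter k pd_step (cl_nbh_set S) \/ k < #|iter k.+1 pd_step (cl_nbh_set S)|.
  elim: k => [|k IHk] /=.
    case: (set_0Vmem (pd_step (cl_nbh_set S))) => [s0|[x xA]].
      by left; apply/eqP; rewrite eqEsubset sub_pd_step s0 sub0set.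
    by right; apply/card_gt0P; exists x.
  move: IHk => /=; set A := iter _ _ _ => IHk.
  case: IHk => [e|lt]; first by left; rewrite !e.
  case: (eqVneq (pd_step (pd_step A)) (pd_step A)) => [e|ne]; first by left.
  right; apply: leq_ltn_trans lt _; apply: proper_card.
  by rewrite properEneq eq_sym ne sub_pd_step.
have: pd_step (PD S) = PD S.
  by case: (grow #|G|) => // lt; move: (leq_trans lt (max_card _)); rewrite ltnn.
rewrite /pd_step; case: pickP => [w /andP[_ /eqP c1] e|n0 _]; last by rewrite n0.
suff: nbh w \subset PD S by rewrite -setD_eq0 => /eqP z; rewrite z cards0 in c1.
by rewrite -e subsetUr.
Qed.

Lemma forced_sub A B v :
  A \subset B -> (forall w, ~~ forces B w) -> forces A v -> A :|: nbh v \subset B.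
Proof.
move=> sAB finB /andP[vA /eqP c1]; rewrite subUset sAB -setD_eq0 -cards_eq0.
move: (finB v); rewrite /forces (subsetP sAB) //=.
have := subset_leq_card (setDS (nbh v) sAB); rewrite c1.
by case: #|_| => [|[]].
Qed.

Lemma PD_unique S A :
    connect (fun B C => [exists v, forces B v && (C == B :|: nbh v)])
      (cl_nbh_set S) A ->
    (forall v, ~~ forces A v) ->
  A = PD S.
Proof.
move=> /connectP[p run ->] finA; apply/eqP; rewrite eqEsubset; apply/andP; split.
  have: cl_nbh_set S \subset PD S.
    rewrite /PD; elim: #|G| => //= k IHk; exact: subset_trans IHk (sub_pd_step _).
  elim: p (cl_nbh_set S) run {finA A} => //= C p IHp B /andP[/existsP[v]].
  move=> /andP[fv /eqP->] run sB; apply: IHp run _.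
  exact: forced_sub sB (PD_final S) fv.
have: cl_nbh_set S \subset last (cl_nbh_set S) p.
  elim: p (cl_nbh_set S) run {finA} => //= C p IHp B /andP[/existsP[v]].
  move=> /andP[_ /eqP eC] run; apply: subset_trans (IHp _ run).
  by rewrite eC subsetUl.
move=> sS; rewrite /PD; elim: #|G| => //= k IHk.
rewrite {1}/pd_step; case: pickP => // v; exact: forced_sub.
Qed.

Lemma power_dominatingT : power_dominating [set: G].
Proof.
rewrite /power_dominating -subTset /PD; elim: #|G| => /= [|k IHk].
  by apply/subsetP=> x _; apply/bigcupP; exists x; rewrite ?inE ?eqxx.
exact: subset_trans IHk (sub_pd_step _).
Qed.

End PowerDomination.

(* Main.v *)
(** Upper bound on [gamma_P(G)]. Call two vertices twins if they have the same
    neighbours apart from each other; since no component is K_{3,3}, at most two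
    vertices share an open neighbourhood. A maximal set [S0] of vertices having
    a twin with [|N[S0]| = 4|S0|] observes a vertex of every twin pair. Extend it
    to a maximal [S] with [4|S| <= |PD(S)|]. If some vertex were unobserved, every
    observed vertex with an unobserved neighbour would have exactly two of them;
    contracting it to an edge turns the unobserved part into a cubic multigraph
    without triple edges (these come from twins), in which selecting a suitable
    vertex observes at least four new vertices, contradicting maximality.

    Complement. As [n > 4], some two vertices have at most one common neighbour in
    [G]. They dominate all of the complement but that neighbour, which is
    then forced.

    Sharpness. Disjoint unions of copies of K_4. *)

Require Import Defs.
From mathcomp Require Import all_boot.
From mathcomp Require Import zify.

Set Implicit Arguments.
Unset Strict Implicit.
Unset Printing Implicit Defensive.

(** * Observed sets and the power domination number in general graphs *)

Section Observation.
Variable G : sgraph.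
Implicit Types (u v w x y b : G) (S A B : {set G}).

Lemma cl_nbh_sub_set S v : v \in S -> cl_nbh v \subset cl_nbh_set S.
Proof. by move=> vS; apply: bigcup_sup. Qed.

Lemma cl_nbh_set_sub_PD S : cl_nbh_set S \subset PD S.
Proof. by rewrite /PD; elim: #|G| => //= k IHk; apply: subset_trans IHk (sub_pd_step _). Qed.

Lemma cl_nbh_sub_PD S v : v \in S -> cl_nbh v \subset PD S.
Proof. by move=> /cl_nbh_sub_set vS; apply: subset_trans vS (cl_nbh_set_sub_PD S). Qed.

Lemma PD_min S B :
  cl_nbh_set S \subset B -> (forall v, ~~ forces B v) -> PD S \subset B.
Proof.
move=> sSB finB; rewrite /PD; elim: #|G| => //= k IHk.
by rewrite {1}/pd_step; case: pickP => // v; apply: forced_sub.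
Qed.

Lemma PD_mono S S' : S \subset S' -> PD S \subset PD S'.
Proof.
move=> sSS'; apply: PD_min => [|v]; last exact: PD_final.
apply/bigcupsP => v vS; apply: cl_nbh_sub_PD; exact: subsetP vS.
Qed.

Lemma PD_force S v x :
  v \in PD S -> adj v x -> nbh v :\ x \subset PD S -> x \in PD S.
Proof.
move=> vS vx sub; apply: contraT => xS.
have := PD_final S v; rewrite /forces vS /= => /negP[]; apply/cards1P; exists x.
apply/setP => y; rewrite !inE; case: (eqVneq y x) => [->|yx]; first by rewrite xS vx.
by apply/negP => /andP[yS vy]; rewrite (subsetP sub) ?inE ?yx in yS.
Qed.

(** A vertex outside [S] enters only as a neighbour of an observed one. In a cubic graph this leaves
    an observed vertex at most two unobserved neighbours. *)
Lemma PD_supported S x : x \in PD S -> x \in S \/ exists2 y, adj x y & y \in PD S.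
Proof.
rewrite /PD; elim: #|G| x => [|k IHk] x /=.
  case/bigcupP => v vS; rewrite !inE => /orP[/eqP->|vx]; first by left.
  by right; exists v; rewrite 1?adj_sym ?(subsetP (cl_nbh_sub_set vS)) ?inE ?eqxx.
move: IHk; set A := iter _ _ _ => IHk xA.
have [xA'|] := boolP (x \in A).
  case: (IHk x xA') => [|[y xy yA]]; [by left | right; exists y => //].
  by apply: subsetP yA; apply: sub_pd_step.
move: xA; rewrite /pd_step; case: pickP => [v /andP[vA _]|_ ->] //.
rewrite !inE => /orP[->|vx] // _.
by right; exists v; rewrite ?inE ?vA // adj_sym.
Qed.

Lemma power_dom_number_le S : power_dominating S -> power_dom_number G <= #|S|.
Proof.
by rewrite /power_dom_number; case: arg_minnP => [|A _]; [apply: power_dominatingT | apply].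
Qed.

Lemma power_dom_number_ge k :
  (forall S, power_dominating S -> k <= #|S|) -> k <= power_dom_number G.
Proof.
by rewrite /power_dom_number => H; case: arg_minnP => [|A PA _]; [apply: power_dominatingT | apply: H].
Qed.

(** Double counting of the pairs [(w, b)] with [w] in [A] and [b] in [B] a common neighbour of [u]
    and [w]. *)
Lemma sum_common u A B :
  \sum_(w in A) #|nbh u :&: nbh w :&: B| = \sum_(b in nbh u :&: B) #|nbh b :&: A|.
Proof.
transitivity (\sum_(w in A) \sum_(b in nbh u :&: B) adj b w).
  apply: eq_bigr => w _; rewrite -sum1_card big_mkcond [RHS]big_mkcond.
  apply: eq_bigr => b _; rewrite !inE [adj w b]adj_sym.
  by case: (adj u b); case: (adj b w); case: (b \in B).
rewrite exchange_big; apply: eq_bigr => b _; rewrite -sum1_card big_mkcond [RHS]big_mkcond.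
by apply: eq_bigr => w _; rewrite !inE; case: (w \in A); case: (adj b w).
Qed.

End Observation.

(** The only way to write 3 with at most two positive parts, each at most 2, is 2 + 1. *)
Lemma sum3_two_one (T : finType) (A : {set T}) (f : T -> nat) :
  \sum_(x in A) f x = 3 -> (forall x, x \in A -> f x <= 2) ->
  #|[set x in A | 0 < f x]| <= 2 ->
  exists x y, [/\ x \in A, y \in A, f x = 2, f y = 1
                & forall z, z \in A -> 0 < f z -> z = x \/ z = y].
Proof.
move=> sum3 f2; set P := [set x in A | _] => P2.
have sumP : \sum_(x in P) f x = 3.
  rewrite -sum3 [RHS](bigID (fun x => 0 < f x)) /= [X in _ + X]big1 ?addn0 => [|x /andP[_]].
    by apply: eq_bigl => x; rewrite inE.
  by case: (f x).
have inP z : (z \in P) = (z \in A) && (0 < f z) by rewrite inE.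
case: (leqP #|P| 1) => [|P1].
  case: (set_0Vmem P) => [P0|[x xP]] le1; first by rewrite P0 big_set0 in sumP.
  have eP : P = [set x] by apply/esym/eqP; rewrite eqEcard sub1set xP cards1.
  have := f2 x; rewrite inP in xP; case/andP: xP => -> _ /(_ isT).
  by move: sumP; rewrite eP big_set1 => ->.
have /eqP/cards2P[x [y [xy eP]]] : #|P| = 2 by lia.
have := inP x; have := inP y; rewrite eP !inE !eqxx orbT => /esym/andP[yA fy] /esym/andP[xA fx].
have supp z : z \in A -> 0 < f z -> z = x \/ z = y.
  by move=> zA fz; have := inP z; rewrite eP zA fz !inE => /orP[]/eqP; auto.
move: sumP; rewrite eP big_setU1 ?inE //= big_set1.
have := f2 x xA; have := f2 y yA => f2y f2x s3.
have [ex|ne] := eqVneq (f x) 2; first by exists x, y; split=> //; lia.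
by exists y, x; split=> //; [lia | lia | move=> z zA /(supp z zA)[]; auto].
Qed.

(** * Cubic graphs: the contracted multigraph on the unobserved vertices *)

Section Cubic.
Variable G : sgraph.
Hypothesis cubic : regular 3 G.
Implicit Types (u v w x y b : G) (S A B : {set G}).

Lemma card_cubic v : #|nbh v| = 3.
Proof. exact: cubic. Qed.

Lemma card_cl_nbh v : #|cl_nbh v| = 4.
Proof. by rewrite /cl_nbh cardsU1 card_cubic inE adj_irr. Qed.

(** Exactly one is excluded because the process has stopped; three are excluded because [b], not
    being in [S], has an observed neighbour. *)
Lemma card_unobserved_nbh S b u :
  b \in PD S -> adj b u -> u \notin PD S -> #|nbh b :\: PD S| = 2.
Proof.
move=> bS bu uS; apply/eqP; rewrite eqn_leq; apply/andP; split.
  case: (PD_supported bS) => [bS'|[y bY yS]].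
    by case/negP: uS; apply: (subsetP (cl_nbh_sub_PD bS')); rewrite !inE bu orbT.
  have := cardsID (PD S) (nbh b); rewrite card_cubic.
  by have /card_gt0P : exists y, y \in nbh b :&: PD S; [exists y; rewrite !inE bY | lia].
have := PD_final S b; rewrite /forces bS /=.
have : 0 < #|nbh b :\: PD S| by apply/card_gt0P; exists u; rewrite !inE bu uS.
by lia.
Qed.

(** Observation travels along a contracted edge: [y] and [z] are the only unobserved neighbours of
    [b], so once [y] is observed, [b] forces [z]. *)
Lemma PD_force_through S S' b y z :
  S \subset S' -> b \in PD S -> adj b y -> adj b z ->
  y \notin PD S -> z \notin PD S -> y != z -> y \in PD S' -> z \in PD S'.
Proof.
move=> sSS' bS bY bz yS zS yz yS'; have sub := PD_mono sSS'.
apply: (@PD_force _ _ b) => //; first exact: subsetP bS.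
have e : [set y; z] = nbh b :\: PD S.
  apply/eqP; rewrite eqEcard (card_unobserved_nbh bS bY yS) cards2 yz andbT.
  by apply/subsetP => x; rewrite !inE => /orP[]/eqP->; apply/andP.
apply/subsetP => x; rewrite !inE => /andP[xz bx].
have [xS|xS] := boolP (x \in PD S); first exact: subsetP xS.
have : x \in [set y; z] by rewrite e !inE xS.
by rewrite !inE (negPf xz) orbF => /eqP->.
Qed.

Definition twin u v := (u != v) && (nbh u :\ v == nbh v :\ u).

(* In the multigraph on the unobserved vertices obtained by contracting each
   observed vertex with two unobserved neighbours to an edge, [mult S u w] is
   the multiplicity of the edge [u w]; this multigraph is again cubic. *)
Definition mult S u w : nat := adj u w + #|nbh u :&: nbh w :&: PD S|.

Lemma multC S u w : mult S u w = mult S w u.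
Proof. by rewrite /mult adj_sym [nbh u :&: _]setIC. Qed.

(** Each neighbour of [u] contributes one edge: an unobserved one directly, an observed one through
    its unique other unobserved neighbour. *)
Lemma mult_sum S u : u \notin PD S -> \sum_(w in ~: PD S :\ u) mult S u w = 3.
Proof.
move=> uS; rewrite big_split /= sum_common.
rewrite [X in _ + X](eq_bigr (fun=> 1)) ?sum1_card => [|b].
  rewrite -(card_cubic u) -(cardsID (PD S) (nbh u)) addnC; congr (_ + _).
  rewrite -sum1_card big_mkcond [RHS]big_mkcond; apply: eq_bigr => w _; rewrite !inE.
  have [->|_] := eqVneq w u; first by rewrite adj_irr andbF.
  by case: (w \in PD S); case: (adj u w).
rewrite !inE => /andP[ub bS]; rewrite adj_sym in ub.
have -> : nbh b :&: (~: PD S :\ u) = (nbh b :\: PD S) :\ u.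
  by apply/setP => w; rewrite !inE; case: (w == u); case: (w \in PD S); case: (adj b w).
have := cardsD1 u (nbh b :\: PD S); rewrite (card_unobserved_nbh bS ub uS) !inE uS ub.
by lia.
Qed.

(** A triple edge uses up all three neighbours of both ends, so apart from each other [u] and [w]
    have the same neighbours. *)
Lemma mult_le2 S u w : u != w -> ~~ twin u w -> mult S u w <= 2.
Proof.
move=> uw; apply: contraR; rewrite -ltnNge /mult /twin uw /= => m3.
set X := nbh u :&: nbh w :&: PD S in m3.
have cu := cardsD1 w (nbh u); have cw := cardsD1 u (nbh w).
rewrite card_cubic inE in cu; rewrite card_cubic inE adj_sym in cw.
have eu : X = nbh u :\ w.
  apply/eqP; rewrite eqEcard; apply/andP; split; last by lia.
  apply/subsetP => x; rewrite !inE => /andP[/andP[-> wx] _].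
  by case: eqVneq wx => // ->; rewrite adj_irr.
have ew : X = nbh w :\ u.
  apply/eqP; rewrite eqEcard; apply/andP; split; last by lia.
  apply/subsetP => x; rewrite !inE => /andP[/andP[ux ->] _].
  by case: eqVneq ux => // ->; rewrite adj_irr.
by rewrite -eu -ew.
Qed.

Lemma mult_observed S v w :
  v \notin PD S -> w \notin PD S -> v != w -> 0 < mult S v w ->
  w \in PD (v |: S).
Proof.
move=> vS wS vw; have sub : S \subset v |: S by apply: subsetUr.
have sv : cl_nbh v \subset PD (v |: S) by apply: cl_nbh_sub_PD; rewrite !inE eqxx.
rewrite /mult; case: (boolP (adj v w)) => [a _|_ /card_gt0P[b]].
  by apply: (subsetP sv); rewrite !inE a orbT.
rewrite !inE => /andP[/andP[vb wb] bS].
apply: (@PD_force_through S _ b v) => //; rewrite 1?adj_sym //.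
by apply: (subsetP sv); rewrite !inE eqxx.
Qed.

(** If no vertex gained four, every unobserved vertex would have one double and one single edge.
    Take the double edge [u w] and the single edges from [u] to [x] and from [w] to [y]: selecting
    [u] observes these four distinct vertices. *)
Lemma gain4 S u :
  (forall v w, twin v w -> v \in PD S \/ w \in PD S) ->
  u \notin PD S ->
  exists2 v, v \notin PD S & #|PD S| + 4 <= #|PD (v |: S)|.
Proof.
move=> notwin uS.
case: (pickP (fun v => (v \notin PD S) && (#|PD S| + 4 <= #|PD (v |: S)|))) => [v /andP[]|no].
  by exists v.
have gain v (W : {set G}) : v \notin PD S -> W \subset PD (v |: S) :\: PD S -> #|W| <= 3.
  move=> vS sW; have := no v; rewrite vS /=; have := subset_leq_card sW.
  have := PD_mono (subsetUr [set v] S) => /setIidPr.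
  by have := cardsID (PD S) (PD (v |: S)) => + e; rewrite e; lia.
have vin v : v \in PD (v |: S).
  by apply: (subsetP (cl_nbh_sub_PD (setU11 _ _))); rewrite !inE eqxx.
(* A selected vertex observes itself and all its multigraph neighbours, so a gain of at most three
   leaves at most two such neighbours. *)
have split21 v : v \notin PD S -> exists x y, [/\ x \in ~: PD S :\ v, y \in ~: PD S :\ v,
    mult S v x = 2, mult S v y = 1
  & forall z, z \in ~: PD S :\ v -> 0 < mult S v z -> z = x \/ z = y].
  move=> vS; apply: sum3_two_one (mult_sum vS) _ _ => [x|].
    rewrite !inE => /andP[xv xS]; apply: mult_le2; first by rewrite eq_sym.
    by apply/negP => /notwin[]; apply/negP.
  set P := [set x in _ | _].
  have := @gain v (v |: P) vS; rewrite cardsU1 !inE eqxx /= ltnS; apply.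
  apply/subsetP => x; rewrite !inE => /orP[/eqP->|]; first by rewrite vS vin.
  move=> /andP[/andP[xv xS] mx]; rewrite xS /=.
  by apply: mult_observed => //; rewrite eq_sym.
have [w [x [wU xU mw mx supu]]] := split21 u uS.
rewrite !inE in wU xU; case/andP: wU => wu wS; case/andP: xU => xu xS.
have [u' [y [u'U yU mu' my suppw]]] := split21 w wS.
have [eu|eu] : u = u' \/ u = y by apply: suppw; rewrite ?inE ?uS 1?eq_sym ?wu // multC mw.
  2: by move: my; rewrite -eu multC mw.
subst u'; rewrite !inE in yU; case/andP: yU => yw yS.
have yu : y != u by apply: contraPneq my => ->; rewrite multC mw.
have xw : x != w by apply: contraPneq mx => ->; rewrite mw.
(* Otherwise [x] would have single edges to both [u] and [w], but only one neighbour is joined to it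
   by a single edge. *)
have yx : y != x.
  apply: contraPneq my => -> m1.
  have [p [q [_ _ mp mq suppx]]] := split21 x xS.
  have [e1|e1] : u = p \/ u = q.
    by apply: suppx; rewrite ?inE ?uS 1?eq_sym ?xu // multC mx.
    by move: mp; rewrite -e1 multC mx.
  have [e2|e2] : w = p \/ w = q.
    by apply: suppx; rewrite ?inE ?wS 1?eq_sym ?xw // multC m1.
    by move: mp; rewrite -e2 multC m1.
  by rewrite e1 e2 eqxx in wu.
have win : w \in PD (u |: S) by apply: mult_observed; rewrite 1?eq_sym ?mw.
have xin : x \in PD (u |: S) by apply: mult_observed; rewrite 1?eq_sym ?mx.
(* The edge [w y] is either an original one, and [w] forces [y] since [u] is now observed, or it
   passes through an observed [b], which forces [y]. *)
have yin : y \in PD (u |: S).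
  have sub : S \subset u |: S by apply: subsetUr.
  case: (set_0Vmem (nbh w :&: nbh y :&: PD S)) => [e0|[b]].
    move: (my); rewrite /mult e0 cards0 addn0; case: (boolP (adj w y)) => // wy _.
    apply: (@PD_force _ _ w) => //; apply/subsetP => z; rewrite !inE => /andP[zy wz].
    have [zS|zS] := boolP (z \in PD S); first exact: subsetP (PD_mono sub) _ zS.
    have [->|ey] : z = u \/ z = y.
      apply: suppw; rewrite ?inE ?zS ?andbT ?/mult ?wz //.
      by apply: contraTneq wz => ->; rewrite adj_irr.
      exact: vin.
    by rewrite ey eqxx in zy.
  rewrite !inE => /andP[/andP[wb yb] bS].
  by apply: (@PD_force_through S _ b w) => //; rewrite 1?adj_sym // eq_sym.
have := @gain u (y |: (x |: (w |: [set u]))) uS.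
rewrite !cardsU1 cards1 !inE (negPf yu) (negPf xw) (negPf wu) (negPf yx) (negPf yw) (negPf xu) /=.
move=> H; suff /H : y |: (x |: (w |: [set u])) \subset PD (u |: S) :\: PD S by [].
by apply/subsetP => z; rewrite !inE => /or4P[]/eqP->; apply/andP.
Qed.

(** The form in which the exclusion of components K_{3,3} enters the argument. *)
Hypothesis no_triplet : forall u v w, u != v -> v != w -> u != w ->
  nbh u = nbh v -> nbh v = nbh w -> False.

Lemma twin_nbh u v : twin u v -> ~~ adj u v -> nbh u = nbh v.
Proof.
move=> /andP[uv /eqP e] nuv; apply/setP => x; move/setP/(_ x): e; rewrite !inE.
have [->|_] := eqVneq x v; first by rewrite (negPf nuv) adj_irr.
by have [->|_] := eqVneq x u; first by rewrite adj_sym (negPf nuv) adj_irr.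
Qed.

Lemma twin_sym u v : twin u v = twin v u.
Proof. by rewrite /twin eq_sym [_ == nbh v :\ u]eq_sym. Qed.

Lemma twin_adj u v x : twin u v -> x != v -> adj u x -> adj v x.
Proof.
by move=> /andP[uv /eqP/setP/(_ x)]; rewrite !inE => e xv ux; move: e; rewrite xv ux => /esym/andP[].
Qed.

Lemma twin_set : exists S, 4 * #|S| <= #|PD S| /\
  (forall v w, twin v w -> v \in PD S \/ w \in PD S).
Proof.
(* Closed neighbourhoods have four vertices, so the inequality says that those of the members of [S]
   are pairwise disjoint. *)
pose P S := [forall s in S, [exists t, twin s t]] && (4 * #|S| <= #|cl_nbh_set S|).
have P0 : P set0.
  by apply/andP; split; [apply/forall_inP => s; rewrite inE | rewrite cards0].
have [S /maxsetP[/andP[/forall_inP tS cS] maxS] _] := maxset_exists P0.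
exists S; split; first exact: leq_trans cS (subset_leq_card (cl_nbh_set_sub_PD S)).
suff H v w : twin v w -> v \in cl_nbh_set S \/ w \in cl_nbh_set S.
  by move=> v w /H[] i; [left|right]; apply: (subsetP (cl_nbh_set_sub_PD S)).
move=> vw; have [|vS] := boolP (v \in cl_nbh_set S); first by left.
have [|wS] := boolP (w \in cl_nbh_set S); first by right.
have out x s : x \notin cl_nbh_set S -> s \in S -> (x != s) && ~~ adj s x.
  move=> xS sS; rewrite -negb_or; apply: contra xS => xs.
  by apply: (subsetP (cl_nbh_sub_set sS)); rewrite !inE.
(* If [cl_nbh v] misses [cl_nbh_set S], then [v] can be added, against maximality. Otherwise they
   share a vertex [b], adjacent to [v], to its twin [w] and to some [s] in [S]. *)
have [dis|] := boolP [disjoint cl_nbh v & cl_nbh_set S].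
  have vS' : v \notin S by apply/negP => /(out _ _ vS); rewrite eqxx.
  have : v |: S = S.
    apply: maxS; last exact: subsetUr.
    apply/andP; split.
      apply/forall_inP => s; rewrite !inE => /orP[/eqP->|/tS//].
      by apply/existsP; exists w.
    rewrite /cl_nbh_set (bigcup_setU [set v]) big_set1 -/(cl_nbh_set S) cardsU1 vS'.
    have := dis; rewrite -setI_eq0 => /eqP e.
    by rewrite cardsU e cards0 card_cl_nbh subn0; lia.
  by move=> e; rewrite -e setU11 in vS'.
rewrite -setI_eq0 => /set0Pn[b]; rewrite inE => /andP[bv bS]; exfalso.
move: (bS) => /bigcupP[s sS bs].
have /andP[vs nsv] := out _ _ vS sS; have /andP[ws nsw] := out _ _ wS sS.
have bv' : b != v by apply: contraNneq vS => <-.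
have bw' : b != w by apply: contraNneq wS => <-.
have vb : adj v b by move: bv; rewrite !inE (negPf bv').
have wb := twin_adj vw bw' vb.
have bs' : b != s by apply: contraNneq nsv => <-; rewrite adj_sym.
have sb : adj s b by move: bs; rewrite !inE (negPf bs').
have vw' : v != w by case/andP: vw.
have eb : [set v; w; s] = nbh b.
  apply/eqP; rewrite eqEcard card_cubic; apply/andP; split.
    by apply/subsetP => x; rewrite !inE => /orP[/orP[]|]/eqP->; rewrite adj_sym.
  by rewrite setUC cardsU1 cards2 !inE vw' negb_or eq_sym vs eq_sym ws.
(* The twin [t] of [s] is also adjacent to [b], hence is [v] or [w]; then [s], [v] and [w] share one
   open neighbourhood. *)
have /existsP[t st] := tS s sS.
have tb : b != t.
  apply: contraNneq nsv => e; rewrite -e in st.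
  by apply: twin_adj (v) _ _ _; first (rewrite twin_sym; exact: st); rewrite // adj_sym.
have : t \in nbh b by rewrite inE adj_sym (twin_adj st).
have ts : t != s by case/andP: st; rewrite eq_sym.
have K x y : twin x y -> twin s x -> x != s -> y != s -> ~~ adj s x -> ~~ adj s y -> False.
  move=> xy sx xs ys nx ny; have e := twin_nbh sx nx.
  have nxy : ~~ adj x y by move/setP/(_ y): e; rewrite !inE => <-.
  apply: no_triplet e (twin_nbh xy nxy) => //; rewrite 1?eq_sym //.
  by case/andP: xy; rewrite eq_sym.
rewrite -eb !inE (negPf ts) orbF => /orP[]/eqP e; rewrite e in st.
  exact: K vw st _ _ _ _.
by apply: K (w) (v) _ st _ _ _ _ => //; rewrite twin_sym.
Qed.

Theorem cubic_power_dominating : exists2 S : {set G}, power_dominating S & 4 * #|S| <= #|G|.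
Proof.
have [S0 [c0 t0]] := twin_set.
(* Keeping [S0] inside [S] preserves the condition on twins that [gain4] requires. *)
pose Q S := (S0 \subset S) && (4 * #|S| <= #|PD S|).
have Q0 : Q S0 by rewrite /Q subxx.
have [S /maxsetP[/andP[sS cS] maxS] _] := maxset_exists Q0.
exists S; last exact: leq_trans cS (max_card _).
rewrite /power_dominating -subTset; apply/subsetP => u _; apply: contraT => uS.
have [|v vS gain] := @gain4 S u _ uS.
  by move=> v w /t0[] i; [left|right]; apply: subsetP i; apply: PD_mono.
have vS' : v \notin S.
  by apply: contra vS => vS; apply: (subsetP (cl_nbh_sub_PD vS)); rewrite !inE eqxx.
suff e : v |: S = S by rewrite -e setU11 in vS'.
apply: maxS; last exact: subsetUr.
by rewrite /Q (subset_trans sS (subsetUr _ _)) cardsU1 vS' /=; lia.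
Qed.

(** * Power domination of the complement *)

Lemma compl_power_dom_number : 6 <= #|G| -> power_dom_number (complement G) <= 2.
Proof.
move=> n6; have [u _] : exists u : G, u \in G by apply/card_gt0P; apply: leq_trans n6.
(* Otherwise each of the n - 1 other vertices shares at least two neighbours with [u], while each of
   the three neighbours of [u] has two further neighbours: 2(n - 1) <= 6, so n <= 4. *)
have [v uv c1] : exists2 v, u != v & #|nbh u :&: nbh v| <= 1.
  case: (pickP (fun v => (u != v) && (#|nbh u :&: nbh v| <= 1))) => [v /andP[]|no]; first by exists v.
  have := sum_common u (~: [set u]) setT.
  have : \sum_(b in nbh u :&: setT) #|nbh b :&: ~: [set u]| <= \sum_(b in nbh u) 2.
    rewrite setIT; apply: leq_sum => b; rewrite inE => ub.
    rewrite -setDE; have := cardsD1 u (nbh b); rewrite card_cubic inE adj_sym ub; lia.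
  have : \sum_(w in ~: [set u]) 2 <= \sum_(w in ~: [set u]) #|nbh u :&: nbh w :&: setT|.
    apply: leq_sum => w; rewrite !inE eq_sym => uw; rewrite setIT.
    by have := no w; rewrite uw /=; lia.
  rewrite !sum_nat_const card_cubic; have := cardsC1 u; lia.
pose S : {set complement G} := [set u; v].
have -> : 2 = #|S| by rewrite cards2 uv.
apply: power_dom_number_le; rewrite /power_dominating -subTset.
apply/subsetP => x _; apply: contraT => xS.
have outS (s y : complement G) : s \in S -> y \notin PD S -> y \in @nbh G s.
  move=> /cl_nbh_sub_PD/subsetP sub; apply: contraR => ny; apply: sub.
  by rewrite !inE in ny *; rewrite /= /compl_adj ny andbT eq_sym orbN.
have com y : y \notin PD S -> y \in nbh u :&: nbh v.
  by move=> yS; apply/setIP; split; apply: outS yS; rewrite !inE eqxx ?orbT.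
have uniq y : y \notin PD S -> y = x.
  move=> yS; apply/eqP; apply: contraTT c1 => yx; rewrite -ltnNge.
  have := subset_leq_card (_ : [set x; y] \subset nbh u :&: nbh v).
  rewrite cards2 eq_sym yx; apply.
  by apply/subsetP => z /set2P[]->; apply: com.
(* [z] exists because n > 4. It is adjacent to [x] in the complement and, [x] being the only
   unobserved vertex, it forces [x]. *)
have [z zx] : exists z : G, z \notin @cl_nbh G x.
  apply/existsP; rewrite -negb_forall; apply/negP => /forallP all.
  have : #|@cl_nbh G x| = #|G| by apply: eq_card => z; rewrite all.
  by rewrite card_cl_nbh; lia.
rewrite !inE negb_or adj_sym in zx.
apply: contraNT (xS) => _; apply: (@PD_force (complement G) S z x).
- by apply: contraT => /uniq e; rewrite e eqxx in zx.
- exact: zx.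
by apply/subsetP => y; rewrite !inE => /andP[yx _]; apply: contraT => /uniq e; rewrite e eqxx in yx.
Qed.

End Cubic.

(** * Three vertices with a common neighbourhood span a K_{3,3} component *)

Lemma triplet_K33 (G : sgraph) (u v w : G) :
  regular 3 G -> u != v -> v != w -> u != w -> nbh u = nbh v -> nbh v = nbh w ->
  exists2 C : {set G}, C \in components G & isomorphic (induced C) (complete_bipartite 3 3).
Proof.
move=> cubic uv vw uw euv evw.
pose A := [set u; v; w]; pose B := nbh u; pose C := [set y | connect adj u y].
have cA : #|A| = 3 by rewrite /A setUC cardsU1 cards2 !inE uv negb_or eq_sym uw eq_sym vw.
have cB : #|B| = 3 by apply: card_cubic.
have adjA x : x \in A -> nbh x = B.
  by rewrite !inE => /orP[/orP[]|]/eqP->; rewrite /B ?euv ?evw.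
have adjAE x y : x \in A -> adj x y = (y \in B) by move=> /adjA <-; rewrite inE.
(* Vertices of [B] are adjacent to all of [A], which exhausts their degree; hence [A :|: B] is
   closed under adjacency. *)
have adjB x : x \in B -> nbh x = A.
  move=> xB; apply/esym/eqP; rewrite eqEcard cA card_cubic // andbT.
  by apply/subsetP => y yA; rewrite inE adj_sym adjAE.
have adjBE x y : x \in B -> adj x y = (y \in A) by move=> /adjB <-; rewrite inE.
have disj x : x \in A -> x \notin B by move=> xA; rewrite -(adjAE x x xA) adj_irr.
have CE : C = A :|: B.
  apply/setP => y; rewrite [LHS]inE; apply/idP/idP.
    have clo : closed adj (A :|: B).
      apply: intro_closed; first by apply/sym_connect_sym/adj_sym.
      move=> x z xz /setUP[] h; apply/setUP.
        by right; rewrite -(adjAE x).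
      by left; rewrite -(adjBE x).
    by move=> /(closed_connect clo) <-; rewrite !inE eqxx.
  have cB' b : b \in B -> connect adj u b by rewrite inE => /connect1.
  case/setUP => [yA|]; last exact: cB'.
  have /card_gt0P[b bB] : 0 < #|B| by rewrite cB.
  by apply: connect_trans (cB' b bB) (connect1 _); rewrite adjBE.
exists C; first by apply/imsetP; exists u.
(* Each vertex is sent to its position in its own side; positions are below 3, so [inord] never
   falls back on its default. *)
pose f (x : induced C) : complete_bipartite 3 3 :=
  if val x \in A then inl (inord (index (val x) (enum A)))
  else inr (inord (index (val x) (enum B))).
have inAB (x : induced C) : val x \notin A -> val x \in B.
  by case/setUP: (eq_ind _ (fun D : {set G} => val x \in D) (valP x) _ CE) => [->|].
exists f.
  apply: inj_card_bij; last first.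
    rewrite card_sum !card_ord card_sig; apply: leq_trans (_ : #|C| <= _).
      rewrite CE cardsU cA cB; suff -> : A :&: B = set0 by rewrite cards0.
      by apply/setP => x; rewrite in_setI in_set0; apply/negP => /andP[/disj/negP].
    by apply/subset_leq_card/subsetP.
  have idx (D : {set G}) (x y : G) : #|D| = 3 -> x \in D -> y \in D ->
      inord (index x (enum D)) = inord (index y (enum D)) :> 'I_3 -> x = y.
    move=> cD xD yD /(congr1 val) /=.
    have lt z : z \in D -> index z (enum D) < 3 by rewrite -cD cardE index_mem mem_enum.
    rewrite !inordK ?lt // => /(congr1 (nth x (enum D))).
    by rewrite !nth_index ?mem_enum.
  move=> x y; rewrite /f; case: ifPn => xA; case: ifPn => yA //; case => e; apply: val_inj.
    exact: idx e.
  by apply: (idx B) e => //; apply: inAB.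
move=> x y; rewrite /f; case: ifPn => xA; case: ifPn => yA /=; rewrite /induced_adj.
- by rewrite adjAE // (negPf (disj _ yA)).
- by rewrite adjAE // inAB.
- by rewrite adjBE ?yA // inAB.
- by rewrite adjBE ?(negPf yA) // inAB.
Qed.

Theorem cubic_product_le (G : sgraph) :
  regular 3 G -> 6 <= #|G| ->
  (forall C : {set G}, C \in components G ->
     ~ isomorphic (induced C) (complete_bipartite 3 3)) ->
  power_dom_number G * power_dom_number (complement G) <= 2 * (#|G| %/ 4).
Proof.
move=> cubic n6 noK33.
have [|S dS cS] := @cubic_power_dominating G cubic.
  by move=> u v w uv vw uw e1 e2; have [C /noK33] := triplet_K33 cubic uv vw uw e1 e2.
rewrite mulnC; apply: leq_mul; first exact: compl_power_dom_number.
by apply: leq_trans (power_dom_number_le dS) _; rewrite leq_divRL // mulnC.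
Qed.

(** * Sharpness: disjoint copies of K_4 *)

Section CopiesOfK4.
Variable m : nat.

Definition K4s_adj : rel ('I_m * 'I_4)%type := fun x y => (x.1 == y.1) && (x.2 != y.2).

Lemma K4s_adj_sym : symmetric K4s_adj.
Proof. by move=> x y; rewrite /K4s_adj eq_sym [x.2 == _]eq_sym. Qed.

Lemma K4s_adj_irr : irreflexive K4s_adj.
Proof. by move=> x; rewrite /K4s_adj !eqxx. Qed.

Definition K4s : sgraph := SGraph K4s_adj_sym K4s_adj_irr.

Lemma card_K4s : #|K4s| = m * 4.
Proof. by rewrite card_prod !card_ord. Qed.

Definition K4s_block (x : K4s) : {set K4s} := [set y | (y.1 == x.1) && (y.2 != x.2)].

Lemma card_K4s_block x : #|K4s_block x| = 3.
Proof.
have -> : K4s_block x = setX [set x.1] (~: [set x.2]).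
  by apply/setP => y; rewrite !inE.
by rewrite cardsX cards1 cardsC1 card_ord.
Qed.

Lemma K4s_cubic : regular 3 K4s.
Proof.
move=> x; rewrite -(card_K4s_block x); apply: eq_card => y; rewrite !inE /= /K4s_adj.
by rewrite eq_sym [x.2 == _]eq_sym.
Qed.

(** Distinct vertices with a common neighbour are adjacent in [K4s], unlike two vertices on the same
    side of K_{3,3}. *)
Lemma K4s_no_K33 (C : {set K4s}) : ~ isomorphic (induced C) (complete_bipartite 3 3).
Proof.
case=> f [g fK gK] fE.
have E p q : adj (g p) (g q) = adj p q by rewrite -fE !gK.
have := E (inr ord0) (inl ord0); have := E (inr ord0) (inl ord_max).
have := E (inl ord0) (inl ord_max); rewrite /= /induced_adj /= /K4s_adj.
move=> + /andP[/eqP e1 _] /andP[/eqP e2 _]; rewrite -e1 -e2 eqxx /= => /negbFE/eqP e.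
have /val_inj/(can_inj gK) : val (g (inl ord0)) = val (g (inl ord_max)).
  by apply: injective_projections; rewrite // -e1 -e2.
by [].
Qed.

(** A copy that misses [S] stays unobserved, since no edge enters it; so [S] meets all [m]
    copies. *)
Lemma K4s_dom : m <= power_dom_number K4s.
Proof.
apply: power_dom_number_ge => S /eqP dS.
suff e : [set x.1 | x in S] = [set: 'I_m].
  by rewrite -[leqLHS](card_ord m) -cardsT -e leq_imset_card.
apply/setP => i; rewrite inE; apply: contraT => iS.
have : PD S \subset [set y : K4s | y.1 != i].
  apply: PD_min => [|v].
    apply/bigcupsP => s sS; have si : s.1 != i by apply: contraNneq iS => <-; apply: imset_f.
    apply/subsetP => y; rewrite !inE => /orP[/eqP->//|/andP[/eqP<-]//].
  rewrite /forces inE; case: eqVneq => //= vi.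
  suff -> : nbh v :\: [set y : K4s | y.1 != i] = set0 by rewrite cards0.
  apply/setP => y; rewrite !inE negbK /= /K4s_adj.
  by case: (eqVneq y.1 i) => //= ->; rewrite (negPf vi).
by rewrite dS => /subsetP/(_ (i, ord0)); rewrite !inE eqxx => /(_ isT).
Qed.

(** With only [v] selected, the other three vertices of its copy stay unobserved: in the complement
    [v] sees none of them, and every vertex of another copy sees all three, so nothing forces. *)
Lemma K4s_compl_dom : 0 < m -> 2 <= power_dom_number (complement K4s).
Proof.
move=> m0; apply: power_dom_number_ge => S /eqP dS; rewrite leqNgt; apply/negP => S1.
have [v sSv] : exists v : K4s, S \subset [set v].
  case: (set_0Vmem S) => [->|[v vS]].
    by exists (Ordinal m0, ord0); apply: sub0set.
  by exists v; rewrite -(_ : S = [set v]) //; apply/esym/eqP; rewrite eqEcard sub1set vS cards1.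
pose B : {set complement K4s} := ~: K4s_block v.
have : PD S \subset B.
  apply: PD_min => [|x].
    apply/bigcupsP => s /(subsetP sSv); rewrite inE => /eqP->.
    apply/subsetP => y; rewrite !inE => /orP[/eqP->|]; first by rewrite !eqxx.
    by case/andP => _; rewrite /= /K4s_adj eq_sym [v.2 == _]eq_sym.
  rewrite /forces; apply/negP => /andP[xB /eqP c1].
  have [xv|xv] := eqVneq x.1 v.1.
    suff e : nbh x :\: B = set0 by rewrite e cards0 in c1.
    move: xB; rewrite !inE xv eqxx negbK => /eqP xv2.
    have -> : x = v by apply: injective_projections.
    apply/setP => y; rewrite !inE /= /compl_adj /= /K4s_adj negbK.
    by apply/negP => /and3P[/andP[/eqP-> ne] _]; rewrite eqxx eq_sym ne.
  have := subset_leq_card (_ : K4s_block v \subset nbh x :\: B).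
  rewrite c1 card_K4s_block.
  suff s : K4s_block v \subset nbh x :\: B by move/(_ s).
  apply/subsetP => y; rewrite !inE negbK => h; rewrite h /= /compl_adj /= /K4s_adj.
  case/andP: h => /eqP yv _; rewrite -yv in xv; rewrite (negPf xv) andbT.
  by apply: contraNneq xv => ->.
rewrite dS => sB.
have /card_gt0P[y yB] : 0 < #|K4s_block v| by rewrite card_K4s_block.
by have := subsetP sB y (in_setT y); rewrite inE yB.
Qed.

End CopiesOfK4.

Theorem corollary4p7 :
  (forall G : sgraph,
     regular 3 G ->
     6 <= #|G| ->
     (forall C : {set G}, C \in components G ->
        ~ isomorphic (induced C) (complete_bipartite 3 3)) ->
     power_dom_number G * power_dom_number (complement G) <= 2 * (#|G| %/ 4))
  /\
  (forall N : nat, exists G : sgraph,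
     [/\ N <= #|G|,
         regular 3 G,
         6 <= #|G|,
         (forall C : {set G}, C \in components G ->
            ~ isomorphic (induced C) (complete_bipartite 3 3))
       & power_dom_number G * power_dom_number (complement G)
           = 2 * (#|G| %/ 4)]).
Proof.
split=> [G|N]; first exact: cubic_product_le.
(* [N.+2] copies have order 4N + 8, at least 6 and at least [N]. *)
have n6 : 6 <= #|K4s N.+2| by rewrite card_K4s; lia.
have noK33 (C : {set K4s N.+2}) : C \in components (K4s N.+2) ->
  ~ isomorphic (induced C) (complete_bipartite 3 3) by move=> _; apply: K4s_no_K33.
exists (K4s N.+2); split=> //; [by rewrite card_K4s; lia | exact: K4s_cubic |].
apply/eqP; rewrite eqn_leq cubic_product_le //=; last exact: K4s_cubic.
by rewrite card_K4s mulnK // mulnC leq_mul ?K4s_dom ?K4s_compl_dom.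
Qed.
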